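(* (Polynomial Bridge Theorem) Let $P(x_1,\dots,x_n)$ be a polynomial with integer coefficients, and let $\mathcal{U}$ be an ultrafilter on $\mathbb{N}$. The following two conditions are equivalent: 1. $\mathcal{U}$ is a $\iota_P$-ultrafilter; 2. there are mutually distinct elements $\alpha_1,\dots,\alpha_n$ in $G_{\mathcal{U}}$ such that $P(\alpha_1,\dots,\alpha_n)=0$.
   Context: $\mathbb{N}=\{1,2,3,\dots\}$. Writing $P(x_1,\dots,x_n)$ means that $x_1,\dots,x_n$ are exactly the variables occurring in $P$; polynomials have constant term equal to zero. An ultrafilter $\mathcal{U}$ on $\mathbb{N}$ is a $\iota_P$-ultrafilter if for every $A\in\mathcal{U}$ there are mutually distinct $a_1,\dots,a_n\in A$ with $P(a_1,\dots,a_n)=0$. Work in a nonstandard model (a star map $*$ between superstructures satisfying the transfer principle) with the $\mathfrak{c}^+$-enlarging property: for every family $\mathcal{F}$ of at most $\mathfrak{c}=2^{\aleph_0}$ subsets of a given standard set, if $\mathcal{F}$ has the finite intersection property then $\bigcap_{A\in\mathcal{F}}{}^*A\neq\emptyset$. ${}^*\mathbb{N}$ is the corresponding hyperextension of $\mathbb{N}$. For an ultrafilter $\mathcal{U}$ on $\mathbb{N}$, its set of generators is $$G_{\mathcal{U}}=\{\alpha\in{}^*\mathbb{N}\mid \mathcal{U}=\{A\subseteq\mathbb{N}\mid\alpha\in{}^*A\}\}=\{\alpha\in{}^*\mathbb{N}\mid \alpha\in{}^*A\text{ for every }A\in\mathcal{U}\}.$$ The equation $P(\alpha_1,\dots,\alpha_n)=0$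 is evaluated in ${}^*\mathbb{Z}$. *)

(* Defs.v *)
From HB Require Import structures.
From mathcomp Require Import all_boot all_order all_algebra.
From mathcomp Require Import boolp classical_sets functions cardinality filter.
From mathcomp Require Import mpoly.
Set Implicit Arguments.
Unset Strict Implicit.
Unset Printing Implicit Defensive.
Import GRing.Theory.
Local Open Scope classical_set_scope.
Local Open Scope ring_scope.

(* V_0 = X and V_(n+1) = V_n `|` P(V_n), for a universe of atoms and sets in
   which [elems v] is the set of the elements of [v]; everything which is not
   an atom counts as a set. *)
Fixpoint stage (T : Type) (atoms : set T) (elems : T -> set T) (n : nat) :
    set T :=
  if n is m.+1 then
    stage atoms elems m
      `|` [set s | ~ atoms s /\ elems s `<=` stage atoms elems m]
  else atoms.

(* The superstructure V(X), the union of the V_n, is given by the properties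
   that determine it up to a unique isomorphism over X: atoms have no elements,
   sets are extensional, every object lies in some V_n, and every
   (external) collection of members of V_n is a set of V_(n+1). *)
Record superstructure (X : Type) := Superstructure {
  univ :> Type;
  atom : X -> univ;
  elems : univ -> set univ;
  atom_inj : injective atom;
  elems_atom : forall x, elems (atom x) = set0;
  elems_inj : forall s t, ~ range atom s -> ~ range atom t ->
    elems s = elems t -> s = t;
  stage_cover : forall v, exists n, stage (range atom) elems n v;
  stage_comprehension : forall n (S : set univ),
    S `<=` stage (range atom) elems n ->
    exists2 s, ~ range atom s & elems s = S
}.

Notation rank V := (stage (range (@atom _ V)) (@elems _ V)).

Section SuperstructureTheory.
Variables (X : Type) (V : superstructure X).
Implicit Types (s t u v : V) (S : set V).

Definition is_set s := ~ range (@atom X V) s.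

Lemma empty_subproof : exists2 s, is_set s & elems s = set0.
Proof. by apply: (@stage_comprehension X V 0) => x. Qed.

(* The set with elements S; it is a junk value if S is contained in no V_n. *)
Definition mkset S : V :=
  if pselect (exists2 s, is_set s & elems s = S) is left ex then
    sval (cid2 ex)
  else sval (cid2 empty_subproof).

Definition upair s t : V := mkset [set s; t].

(* Kuratowski's ordered pair {{s}, {s, t}} *)
Definition kpair s t : V := upair (upair s s) (upair s t).

Lemma mksetP n S : S `<=` rank V n -> is_set (mkset S) /\ elems (mkset S) = S.
Proof.
move=> /stage_comprehension ex; rewrite /mkset; case: pselect => // ex'.
by case: (cid2 _).
Qed.

Lemma rankS n : rank V n `<=` rank V n.+1.
Proof. by move=> x; left. Qed.

Lemma rank_mono m n : (m <= n)%N -> rank V m `<=` rank V n.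
Proof.
move=> /subnK <-; elim: (n - m)%N => // k IH x /IH; exact: rankS.
Qed.

Lemma rank_mkset n S : S `<=` rank V n -> rank V n.+1 (mkset S).
Proof. by move=> /[dup] Sn /mksetP[? e]; right; split=> //; rewrite e. Qed.

Lemma rank_upair n s t : rank V n s -> rank V n t -> rank V n.+1 (upair s t).
Proof. by move=> sn tn; apply: rank_mkset => x [|] ->. Qed.

Lemma rank_kpair n s t : rank V n s -> rank V n t -> rank V n.+2 (kpair s t).
Proof. by move=> sn tn; do 2!apply: rank_upair => //; apply: rank_upair. Qed.

Lemma upairP s t : is_set (upair s t) /\ elems (upair s t) = [set s; t].
Proof.
have [n ns] := stage_cover s; have [m mt] := stage_cover t.
apply: (@mksetP (maxn n m)) => x [|] ->.
- exact: rank_mono (leq_maxl _ _) _ ns.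
- exact: rank_mono (leq_maxr _ _) _ mt.
Qed.

Lemma nonempty_is_set s t : elems s t -> is_set s.
Proof. by move=> + [x _ xs]; rewrite -xs elems_atom. Qed.

Lemma upair_eq s u v : s = upair u v <-> elems s = [set u; v].
Proof.
have [uv euv] := upairP u v; split=> [->//|es].
apply: elems_inj => //; last by rewrite es euv.
by apply: (@nonempty_is_set _ u); rewrite es; left.
Qed.

Lemma upair_inj s t u v : upair s t = upair u v ->
  (s = u /\ t = v) \/ (s = v /\ t = u).
Proof.
move/upair_eq; rewrite (upairP s t).2 => E.
have : [set u; v] s by rewrite -E; left.
have : [set u; v] t by rewrite -E; right.
have : [set s; t] u by rewrite E; left.
have : [set s; t] v by rewrite E; right.
by move=> [|] ? [|] ? [|] ? [|] ?; subst; auto.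
Qed.

Lemma kpair_inj s t u v : kpair s t = kpair u v -> s = u /\ t = v.
Proof.
move/upair_inj => [] [/upair_inj + /upair_inj];
  by case=> [] [? ?] [] [? ?]; subst.
Qed.

End SuperstructureTheory.

(* A model of V(X): the tower X, X + P(X), X + P(X + P(X)), ... modulo the
   identification of the sets of different levels with the same elements. *)
Module Existence.
Section Existence.
Variable X : Type.

Fixpoint tower (n : nat) : Type :=
  if n is m.+1 then (X + set (tower m))%type else X.

Fixpoint same (m n : nat) {struct m} : tower m -> tower n -> Prop :=
  match m return tower m -> tower n -> Prop with
  | 0 => fun x =>
    match n return tower n -> Prop with
    | 0 => fun y => x = y
    | _.+1 => fun b => if b is inl y then x = y else False
    end
  | m'.+1 => fun a =>
    match n return tower n -> Prop with
    | 0 => fun y => if a is inl x then x = y else False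
    | n'.+1 => fun b =>
      match a, b with
      | inl x, inl y => x = y
      | inr A, inr B =>
          (forall u, A u -> exists2 v, B v & @same m' n' u v) /\
          (forall v, B v -> exists2 u, A u & @same m' n' u v)
      | _, _ => False
      end
    end
  end.

Lemma same_refl n a : @same n n a a.
Proof.
elim: n a => //= n IH [//|A]; split=> u Au; exists u => //; exact: IH.
Qed.

Lemma same_sym m n a b : @same m n a b -> same b a.
Proof.
elim: m n a b => [|m IH] [|n] //=; [by move=> ? [?|?]|by move=> [?|?] ?|].
move=> [x|A] [y|B] // [AB BA]; split=> [u /BA|u /AB] [v ? ?];
  by exists v => //; apply: IH.
Qed.

Lemma same_trans m n p a b c :
  @same m n a b -> @same n p b c -> same a c.
Proof.
elim: m n p a b c => [|m IH] [|n] [|p] //=; try by move=> a b c; subst.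
- by move=> a b c ->.
- by move=> a b [c|C] // ->.
- by move=> a [b|B] c // ->.
- by move=> a [b|B] [c|C] // ->.
- by move=> [a|A] b c // ->.
- by move=> [a|A] b [c|C] // ->.
- by move=> [a|A] [b|B] c // ->.
move=> [a|A] [b|B] [c|C] //; first by move=> ->.
move=> [AB BA] [BC CB]; split.
- by move=> u /AB[v /BC[w Cw vw] uv]; exists w => //; apply: IH vw.
- by move=> w /CB[v /BA[u Au uv] vw]; exists u => //; apply: IH vw.
Qed.

Definition raw := {n & tower n}.
Definition same_raw (x y : raw) := same (projT2 x) (projT2 y).

Definition quot := {C : set raw | exists x, C = same_raw x}.
Definition pi (x : raw) : quot := exist _ (same_raw x) (ex_intro _ x erefl).

Lemma piP x y : pi x = pi y <-> same_raw x y.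
Proof.
split=> [[] E|xy]; first by rewrite E; apply: same_refl.
apply: eq_exist; apply/seteqP; split=> z.
- by apply: same_trans; apply: same_sym.
- exact: same_trans.
Qed.

Lemma pi_surj q : exists x, q = pi x.
Proof. by case: q => C [x xE]; exists x; apply: eq_exist. Qed.

Definition lift n (a : tower n) : quot := pi (existT _ n a).

Lemma liftP m n (a : tower m) (b : tower n) : lift a = lift b <-> same a b.
Proof. exact: (piP (existT _ m a) (existT _ n b)). Qed.

Definition raw_elems (x : raw) : set quot :=
  let: existT n a := x in
  match n return tower n -> set quot with
  | 0 => fun=> set0
  | m.+1 => fun a => if a is inr A then @lift m @` A else set0
  end a.

Lemma raw_elems_same x y : same_raw x y -> raw_elems x = raw_elems y.
Proof.
case: x y => [[|m] a] [[|n] b] //=; rewrite /same_raw /=.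
- by case: b.
- by case: a.
case: a b => [a|A] [b|B] //= [AB BA].
apply/seteqP; split=> _ [u + <-].
- by move=> /AB[v Bv uv]; exists v => //; apply/esym/piP.
- by move=> /BA[v Av uv]; exists v => //; apply/piP.
Qed.

Definition qelems (q : quot) : set quot := raw_elems (sval (cid (pi_surj q))).

Lemma qelems_pi x : qelems (pi x) = raw_elems x.
Proof.
rewrite /qelems; case: cid => y /= /piP xy; exact/esym/raw_elems_same.
Qed.

Definition qatom (x : X) : quot := @lift 0 x.

Lemma lift_inr_set n A : ~ range qatom (@lift n.+1 (inr A)).
Proof. by case=> x _ /piP. Qed.

Fixpoint up (n : nat) : tower n -> tower n.+1 :=
  match n return tower n -> tower n.+1 with
  | 0 => fun x => inl x
  | m.+1 => fun a => match a with inl x => inl x | inr A => inr (@up m @` A) end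
  end.

Lemma same_up n a : same a (@up n a).
Proof.
elim: n a => [|n IH] //= [x|A] //; split.
- by move=> u Au; exists (up u); [exists u|].
- by move=> _ [u Au <-]; exists u.
Qed.

Lemma stage_lift n q :
  stage (range qatom) qelems n q <-> exists a : tower n, q = lift a.
Proof.
elim: n q => [|n IH] q /=.
  by split=> [[x _ <-]|[x ->]]; exists x.
split=> [[/IH[a ->]|[qs qn]]|[[x|A] ->]].
- by exists (up a); apply/liftP; apply: same_up.
- case: (pi_surj q) => -[[|m] a] qE; subst.
    by case: qs; exists a.
  case: a qs qn => [x|A] qs qn.
    by case: qs; exists x => //; apply/piP.
  exists (inr [set b | qelems (lift (inr A : tower m.+1)) (lift b)]).
  apply/piP; rewrite /same_raw /=; split.
  + move=> u Au; have : qelems (lift (inr A : tower m.+1)) (lift u).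
      by rewrite qelems_pi; exists u.
    move=> /[dup] uA /qn /IH[b ub]; exists b; first by rewrite /= -ub.
    exact/liftP.
  + move=> b /=; rewrite qelems_pi => -[u Au ub]; exists u => //.
    exact/liftP.
- left; apply/IH; case: n {IH} => [|n]; first by exists x; apply/piP.
  by exists (inl x); apply/piP.
- right; split; first exact: lift_inr_set.
  by rewrite qelems_pi => _ [u Au <-]; apply/IH; exists u.
Qed.

Lemma inhabited_superstructure : inhabited (superstructure X).
Proof.
constructor; apply: (@Superstructure X quot qatom qelems).
- by move=> x y xy; exact: (@liftP 0 0 x y).1 xy.
- by move=> x; rewrite qelems_pi.
- move=> s t; case: (pi_surj s) => -[m a] ->; case: (pi_surj t) => -[n b] ->.
  case: m a => [|m] a; first by case; exists a.
  case: a => [x|A]; first by case; exists x => //; apply/piP.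
  case: n b => [|n] b; first by move=> _; case; exists b.
  case: b => [x|B]; first by move=> _ []; exists x => //; apply/piP.
  move=> _ _; rewrite !qelems_pi /= => E; apply/piP; split.
  + move=> u Au; have : (@lift n @` B) (lift u) by rewrite -E; exists u.
    by case=> v Bv /liftP vu; exists v => //; apply: same_sym.
  + move=> v Bv; have : (@lift m @` A) (lift v) by rewrite E; exists v.
    by case=> u Au /liftP uv; exists u.
- move=> v; case: (pi_surj v) => -[n a] ->; exists n.
  by apply/stage_lift; exists a.
- move=> n S Sn; exists (@lift n.+1 (inr [set a | S (lift a)])).
    exact: lift_inr_set.
  rewrite qelems_pi; apply/seteqP; split=> [_ [a Sa <-] //|q Sq].
  by have /stage_lift[a qa] := Sn q Sq; exists a; rewrite /= -qa.
Qed.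

End Existence.
End Existence.

(* Variables are de Bruijn indices.  A quantifier binds the index 0 in its body
   and ranges over the elements of the set denoted outside of its scope by the
   index [j]. *)
Inductive formula :=
  | FMem (i j : nat)
  | FEq (i j : nat)
  | FNot (f : formula)
  | FAnd (f g : formula)
  | FOr (f g : formula)
  | FImp (f g : formula)
  | FAll (j : nat) (f : formula)
  | FEx (j : nat) (f : formula).

Definition scons (T : Type) (x : T) (e : nat -> T) (n : nat) : T :=
  if n is m.+1 then e m else x.

Fixpoint sat (X : Type) (V : superstructure X) (e : nat -> V) (f : formula) :
    Prop :=
  match f with
  | FMem i j => elems (e j) (e i)
  | FEq i j => e i = e j
  | FNot f => ~ sat e f
  | FAnd f g => sat e f /\ sat e g
  | FOr f g => sat e f \/ sat e g
  | FImp f g => sat e f -> sat e g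
  | FAll j f => forall a, elems (e j) a -> sat (scons a e) f
  | FEx j f => exists2 a, elems (e j) a & sat (scons a e) f
  end.

(* The base set X of the standard superstructure contains a copy of the
   integers.  The environment [e] provides arbitrary parameters from V(X). *)
Record nonstandard_model := NonstandardModel {
  base : Type;
  hyperbase : Type;
  std : superstructure base;
  nonstd : superstructure hyperbase;
  int_base : int -> base;
  int_base_inj : injective int_base;
  star : std -> nonstd;
  transfer : forall (f : formula) (e : nat -> std),
    sat e f <-> sat (star \o e) f
}.

Arguments star {n} _ : rename.

(* The c^+-enlarging property; the cardinality c is that of [set nat]. *)
Definition continuum_enlarging (M : nonstandard_model) : Prop :=
  forall (S : std M) (F : set (std M)),
    is_set S ->
    (forall A, F A -> is_set A /\ elems A `<=` elems S) ->
    (F #<= [set: set nat])%card ->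
    (forall G : set (std M), finite_set G -> G !=set0 -> G `<=` F ->
       \bigcap_(A in G) elems A !=set0) ->
    \bigcap_(A in F) elems (star A) !=set0.

Section Hyperintegers.
Variable M : nonstandard_model.

Definition std_int (c : int) : std M := atom (std M) (int_base M c).

Definition std_ints : std M := mkset (range std_int).

Definition hyperint : Type := set_type (elems (star std_ints)).

HB.instance Definition _ := gen_eqMixin hyperint.
HB.instance Definition _ := gen_choiceMixin hyperint.

Definition op_graph (f : int -> int -> int) : std M :=
  mkset [set kpair (kpair (std_int ab.1) (std_int ab.2))
                   (std_int (f ab.1 ab.2)) | ab in [set: int * int]].

Lemma std_int_inj : injective std_int.
Proof. by move=> a b ab; apply/int_base_inj/atom_inj/ab. Qed.

Lemma rank_std_int n c : rank (std M) n (std_int c).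
Proof. by apply: (@rank_mono _ _ 0) => //; exists (int_base M c). Qed.

Lemma elems_std_ints : elems std_ints = range std_int.
Proof.
by apply: (@mksetP _ _ 0 _ _).2 => _ [c _ <-]; apply: rank_std_int.
Qed.

Lemma elems_op_graph f : elems (op_graph f) =
  [set kpair (kpair (std_int ab.1) (std_int ab.2)) (std_int (f ab.1 ab.2))
     | ab in [set: int * int]].
Proof.
apply: (@mksetP _ _ 4 _ _).2 => _ [[a b] _ <-].
by apply: rank_kpair; [apply: rank_kpair|]; apply: rank_std_int.
Qed.

Lemma op_graphP f a b c :
  elems (op_graph f)
    (kpair (kpair (std_int a) (std_int b)) (std_int c)) <-> c = f a b.
Proof.
rewrite elems_op_graph; split=> [[[a' b'] _]|->]; last by exists (a, b).
by move=> /= /kpair_inj[/kpair_inj[]] /std_int_inj-> /std_int_inj-> /std_int_inj.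
Qed.

Definition FUpair (s u v : nat) : formula :=
  FAnd (FMem u s) (FAnd (FMem v s) (FAll s (FOr (FEq 0 u.+1) (FEq 0 v.+1)))).

Definition FKpair (p a b : nat) : formula :=
  FEx p (FEx p.+1 (FAnd (FUpair 1 a.+2 a.+2)
                  (FAnd (FUpair 0 a.+2 b.+2) (FUpair p.+2 1 0)))).

Definition FOp (g a b c : nat) : formula :=
  FEx g (FEx 0 (FEx 0 (FAnd (FKpair 0 a.+3 b.+3) (FKpair 2 0 c.+3)))).

Section Sat.
Variables (X : Type) (V : superstructure X).
Implicit Type e : nat -> V.

Lemma sat_upair e s u v : sat e (FUpair s u v) <-> e s = upair (e u) (e v).
Proof.
rewrite upair_eq /=; split=> [[us [vs suv]]|es].
  by apply/seteqP; split=> [x /suv|x [|] ->].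
by rewrite es; split; [left|split; [right|]].
Qed.

Lemma sat_kpair e p a b : sat e (FKpair p a b) <-> e p = kpair (e a) (e b).
Proof.
split=> [[u _ [v _ [ua [vab pE]]]]|pE].
  have {}ua : u = upair (e a) (e a).
    exact: (sat_upair (scons v (scons u e)) 1 a.+2 a.+2).1 ua.
  have {}vab : v = upair (e a) (e b).
    exact: (sat_upair (scons v (scons u e)) 0 a.+2 b.+2).1 vab.
  rewrite /kpair -ua -vab.
  exact: (sat_upair (scons v (scons u e)) p.+2 1 0).1 pE.
exists (upair (e a) (e a)); first by rewrite pE (upairP _ _).2; left.
exists (upair (e a) (e b)); first by rewrite /= pE (upairP _ _).2; right.
by split; [|split]; apply/sat_upair.
Qed.

Lemma sat_op e g a b c :
  sat e (FOp g a b c) <-> elems (e g) (kpair (kpair (e a) (e b)) (e c)).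
Proof.
split=> [[t tg [w _ [q _ [qE tE]]]]|abc].
  have {}qE : q = kpair (e a) (e b).
    exact: (sat_kpair (scons q (scons w (scons t e))) 0 a.+3 b.+3).1 qE.
  have {}tE : t = kpair q (e c).
    exact: (sat_kpair (scons q (scons w (scons t e))) 2 0 c.+3).1 tE.
  by rewrite -qE -tE.
exists (kpair (kpair (e a) (e b)) (e c)) => //.
set q := kpair (e a) (e b).
exists (upair q q); first by rewrite /= (upairP _ _).2; left.
exists q; first by rewrite /= (upairP _ _).2; left.
by split; apply/sat_kpair.
Qed.

Lemma sat_opE e g a b c :
  sat e (FOp g a b c) = elems (e g) (kpair (kpair (e a) (e b)) (e c)).
Proof. exact/propext/sat_op. Qed.
End Sat.

Local Opaque FOp.

Definition env (s : seq (std M)) (n : nat) : std M := nth std_ints s n.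

Lemma hyperop_total f (a b : hyperint) : exists c : hyperint,
  elems (star (op_graph f)) (kpair (kpair (val a) (val b)) (val c)).
Proof.
pose phi := FAll 0 (FAll 1 (FEx 2 (FOp 4 2 1 0))).
have /transfer H : sat (env [:: std_ints; op_graph f]) phi.
  move=> x /=; rewrite /env /= elems_std_ints => -[a' _ <-] _ [b' _ <-].
  by exists (std_int (f a' b')); [exists (f a' b')|apply/sat_op/op_graphP].
have [c cZ /sat_op /= abc] := H _ (set_mem (valP a)) _ (set_mem (valP b)).
by exists (SigSub (mem_set cZ)).
Qed.

Definition hyperop f (a b : hyperint) : hyperint :=
  sval (cid (hyperop_total f a b)).

Lemma hyperopP f a b c : hyperop f a b = c <->
  elems (star (op_graph f)) (kpair (kpair (val a) (val b)) (val c)).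
Proof.
rewrite /hyperop; case: cid => d /= abd; split=> [<-//|abc].
pose phi := FAll 0 (FAll 1 (FAll 2 (FAll 3
  (FImp (FOp 5 3 2 1) (FImp (FOp 5 3 2 0) (FEq 1 0)))))).
have /transfer H : sat (env [:: std_ints; op_graph f]) phi.
  move=> x; rewrite /env /= elems_std_ints.
  move=> [x' _ <-] _ [y' _ <-] _ [z' _ <-] _ [w' _ <-].
  by move=> /sat_op/op_graphP -> /sat_op/op_graphP ->.
apply: val_inj; apply: (H _ (set_mem (valP a)) _ (set_mem (valP b)) _
  (set_mem (valP d)) _ (set_mem (valP c))); exact/sat_op.
Qed.

Lemma star_std_int c : elems (star std_ints) (star (std_int c)).
Proof.
have /transfer // : sat (env [:: std_ints; std_int c]) (FMem 1 0).
by rewrite /env /= elems_std_ints; exists c.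
Qed.

Definition hyper_int (c : int) : hyperint := SigSub (mem_set (star_std_int c)).

Lemma hyperop_assoc f : associative f -> associative (hyperop f).
Proof.
move=> fA a b c; set bc := hyperop f b c; set ab := hyperop f a b.
apply/hyperopP; set abc := hyperop f ab c.
pose phi := FAll 0 (FAll 1 (FAll 2 (FAll 3 (FAll 4 (FAll 5
  (FImp (FOp 7 4 3 2) (FImp (FOp 7 5 4 1) (FImp (FOp 7 1 3 0)
     (FOp 7 5 2 0))))))))).
have /transfer H : sat (env [:: std_ints; op_graph f]) phi.
  move=> x; rewrite /env /= elems_std_ints.
  move=> [x' _ <-] _ [y' _ <-] _ [z' _ <-] _ [u' _ <-] _ [v' _ <-] _ [w' _ <-].
  move=> /sat_op/op_graphP -> /sat_op/op_graphP -> /sat_op/op_graphP ->.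
  by apply/sat_op/op_graphP; rewrite fA.
rewrite /phi /= in H; have := H _ (set_mem (valP a)) _ (set_mem (valP b)) _ (set_mem (valP c))
  _ (set_mem (valP bc)) _ (set_mem (valP ab)) _ (set_mem (valP abc)).
rewrite !sat_opE; apply; exact/hyperopP.
Qed.

Lemma hyperop_comm f : commutative f -> commutative (hyperop f).
Proof.
move=> fC a b; apply/hyperopP; set c := hyperop f b a.
pose phi := FAll 0 (FAll 1 (FAll 2 (FImp (FOp 4 1 2 0) (FOp 4 2 1 0)))).
have /transfer H : sat (env [:: std_ints; op_graph f]) phi.
  move=> x; rewrite /env /= elems_std_ints.
  move=> [x' _ <-] _ [y' _ <-] _ [z' _ <-] /sat_op/op_graphP ->.
  by apply/sat_op/op_graphP; rewrite fC.
rewrite /phi /= in H; have := H _ (set_mem (valP a)) _ (set_mem (valP b)) _ (set_mem (valP c)).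
by rewrite !sat_opE; apply; apply/hyperopP.
Qed.

Lemma hyperop_left_id f c : left_id c f -> left_id (hyper_int c) (hyperop f).
Proof.
move=> fc a; apply/hyperopP.
pose phi := FAll 0 (FOp 2 3 0 0).
have /transfer H : sat (env [:: std_ints; op_graph f; std_int c]) phi.
  move=> x; rewrite /env /= elems_std_ints => -[x' _ <-].
  by apply/sat_op/op_graphP; rewrite fc.
by have /sat_op := H _ (set_mem (valP a)).
Qed.

Lemma hyperop_left_distributive f g :
  left_distributive f g -> left_distributive (hyperop f) (hyperop g).
Proof.
move=> fg a b c; set ab := hyperop g a b; set ac := hyperop f a c.
set bc := hyperop f b c; apply/esym/hyperopP; set d := hyperop f ab c.
pose phi := FAll 0 (FAll 1 (FAll 2 (FAll 3 (FAll 4 (FAll 5 (FAll 6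
  (FImp (FOp 9 6 5 3) (FImp (FOp 8 6 4 2) (FImp (FOp 8 5 4 1)
  (FImp (FOp 8 3 4 0) (FOp 9 2 1 0))))))))))).
have /transfer H : sat (env [:: std_ints; op_graph f; op_graph g]) phi.
  move=> x; rewrite /env /= elems_std_ints.
  move=> [x' _ <-] _ [y' _ <-] _ [z' _ <-] _ [u' _ <-] _ [v' _ <-] _ [w' _ <-].
  move=> _ [t' _ <-] /sat_op/op_graphP -> /sat_op/op_graphP ->.
  move=> /sat_op/op_graphP -> /sat_op/op_graphP ->.
  by apply/sat_op/op_graphP; rewrite fg.
rewrite /phi /= in H; have := H _ (set_mem (valP a)) _ (set_mem (valP b)) _ (set_mem (valP c))
  _ (set_mem (valP ab)) _ (set_mem (valP ac)) _ (set_mem (valP bc))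
  _ (set_mem (valP d)).
rewrite !sat_opE; apply; exact/hyperopP.
Qed.

Lemma hyperop_left_inverse f g c : (forall a, g (f c a) a = c) ->
  forall a, hyperop g (hyperop f (hyper_int c) a) a = hyper_int c.
Proof.
move=> gfc a; apply/hyperopP; set b := hyperop f _ a.
pose phi := FAll 0 (FAll 1 (FImp (FOp 3 5 1 0) (FOp 4 0 1 5))).
have /transfer H :
    sat (env [:: std_ints; op_graph f; op_graph g; std_int c]) phi.
  move=> x; rewrite /env /= elems_std_ints.
  move=> [x' _ <-] _ [y' _ <-] /sat_op/op_graphP ->.
  by apply/sat_op/op_graphP; rewrite gfc.
rewrite /phi /= in H; have := H _ (set_mem (valP a)) _ (set_mem (valP b)).
by rewrite !sat_opE; apply; apply: (hyperopP f (hyper_int c) a b).1.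
Qed.

Lemma hyper_int_inj : injective hyper_int.
Proof.
move=> a b /(congr1 val) /= ab.
have : sat (env [:: std_int a; std_int b]) (FEq 0 1) by exact/transfer.
by move=> /= /std_int_inj.
Qed.

HB.instance Definition _ := GRing.isZmodule.Build hyperint
  (hyperop_assoc (@addrA int)) (hyperop_comm (@addrC int))
  (hyperop_left_id (@add0r int))
  (hyperop_left_inverse (f := fun a b => a - b) (c := 0)
     (fun a => subrK a 0)).

HB.instance Definition _ := GRing.Zmodule_isComNzRing.Build hyperint
  (hyperop_assoc (@mulrA int)) (hyperop_comm (@mulrC int))
  (hyperop_left_id (@mul1r int)) (hyperop_left_distributive (@mulrDl int))
  (contra_neq (@hyper_int_inj 1 0) (oner_neq0 int)).

Lemma hyper_int_op f a b :
  hyper_int (f a b) = hyperop f (hyper_int a) (hyper_int b).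
Proof.
apply/esym/hyperopP.
have /transfer/sat_op // : sat (env [:: op_graph f; std_int a; std_int b;
  std_int (f a b)]) (FOp 0 1 2 3) by apply/sat_op/op_graphP.
Qed.

HB.instance Definition _ := GRing.isZmodMorphism.Build int hyperint hyper_int
  (fun a b => etrans (hyper_int_op +%R a (- b)) (congr1 (hyperop +%R _)
     (etrans (congr1 hyper_int (esym (sub0r b)))
       (hyper_int_op (fun a b => a - b) 0 b)))).

HB.instance Definition _ := GRing.isMonoidMorphism.Build int hyperint hyper_int
  (conj erefl (hyper_int_op *%R)).

End Hyperintegers.

Definition posnat : Type := {n : nat | (0 < n)%N}.

Definition int_of_posnat (a : posnat) : int := (val a)%:Z.

Definition all_variables_occur (n : nat) (P : {mpoly int[n]}) : Prop :=
  forall i : 'I_n, exists2 m, m \in msupp P & m i != 0%N.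

Definition iota_ultrafilter (n : nat) (P : {mpoly int[n]})
    (U : set_system posnat) : Prop :=
  UltraFilter U /\
  forall A, U A -> exists a : 'I_n -> posnat,
    [/\ injective a, forall i, A (a i) & P.@[int_of_posnat \o a] = 0].

Section Generators.
Variable M : nonstandard_model.

Definition std_set (A : set posnat) : std M :=
  mkset ((@std_int M \o int_of_posnat) @` A).

Lemma elems_std_set A :
  elems (std_set A) = (@std_int M \o int_of_posnat) @` A.
Proof.
by apply: (@mksetP _ _ 0 _ _).2 => _ [a _ <-]; apply: rank_std_int.
Qed.

Lemma star_std_set_sub A : elems (star (std_set A)) `<=` elems (star (std_ints M)).
Proof.
have /transfer H : sat (env [:: std_ints M; std_set A]) (FAll 1 (FMem 0 1)).
  rewrite /= /env /= elems_std_ints elems_std_set => _ [a _ <-].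
  by exists (int_of_posnat a).
exact: H.
Qed.

(* Hypernaturals are taken among the hyperintegers, which loses nothing by
   [star_std_set_sub]. *)
Definition hypernat : set (hyperint M) :=
  [set x | elems (star (std_set setT)) (val x)].

Definition generators (U : set_system posnat) : set (hyperint M) :=
  [set x | hypernat x /\ U = [set A | elems (star (std_set A)) (val x)]].

Definition hyper_eval (n : nat) (P : {mpoly int[n]})
    (x : 'I_n -> hyperint M) : hyperint M :=
  mmap (@hyper_int M) x P.
End Generators.

(* Main.v *)
Require Import Defs.
From mathcomp Require Import all_boot all_order all_algebra.
From mathcomp Require Import boolp classical_sets functions cardinality filter.
From mathcomp Require Import mpoly.
Local Open Scope classical_set_scope.
Local Open Scope ring_scope.

(** The set {c | c codes a solution of P = 0 with distinct entries in A} is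
    called [solution P A]; finite sequences of integers are coded by integers,
    so that this is a standard set of integers.  [U] is a iota_P-ultrafilter if
    and only if all the sets [solution P A] with A in U are nonempty.

    The bridge between the two conditions is [hyperset_solution]: a
    hyperinteger q lies in the star of [solution P A] if and only if the n
    hyperintegers *e_i(q), with e_i the function taking a code to its i-th
    entry, form a solution of P = 0 with distinct entries in *A.  This is Los's
    theorem for the ultrafilter {S | q is in *S} on the integers: q plays the
    role of the identity in the ultrapower, and f |-> *f(q) ([hyperfun])
    commutes with the ring operations, hence with the evaluation of P
    ([hyper_eval_hyperfun]).  Everything is an instance of transfer for formulas
    with a number of quantifiers independent of n, because a tuple is a single
    integer.

    Suppose that U is a iota_P-ultrafilter.  The sets [solution P A] with A in U
    are nonempty and are monotone in A, so that they have the finite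
    intersection property, and there are at most continuum many of them.  The
    enlarging property yields a q in all of their stars
    ([hypersolution_ex]), and the *e_i(q) are distinct elements of every *A
    with A in U, that is, generators of U.

    Conversely, let x be a tuple of distinct generators of U with P(x) = 0.  By
    transfer of the coding of one more entry, x is the tuple of the *e_i(q) for
    some q ([hyperentry_surj]).  For A in U, this q lies in the star of
    [solution P A], which is therefore nonempty. *)

Set Implicit Arguments.
Unset Strict Implicit.
Unset Printing Implicit Defensive.
Import GRing.Theory.

(** * Coded solutions *)

Lemma nth_enum_ord_map (T : Type) (x0 : T) n (x : 'I_n -> T) (i : 'I_n) :
  nth x0 [seq x j | j <- enum 'I_n] i = x i.
Proof. by rewrite (nth_map i) ?nth_ord_enum // size_enum_ord. Qed.

(** A tuple becomes a single integer, hence an atom of the superstructure, so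
    that a set of tuples is a standard set of rank one and that one quantifier
    over the hyperintegers quantifies over tuples of any length. *)
Definition code (s : seq int) : int := (pickle s)%:Z.
Definition decode (c : int) : seq int := odflt [::] (unpickle `|c|%N).

Definition entry (i : nat) (c : int) : int := (decode c)`_i.

Lemma codeK : cancel code decode.
Proof. by move=> s; rewrite /decode /code absz_nat pickleK. Qed.

Definition solution n (P : {mpoly int[n]}) (A : set posnat) : set int :=
  [set c | [/\ injective (fun i : 'I_n => entry i c),
     forall i : 'I_n, (int_of_posnat @` A) (entry i c) &
     P.@[fun i => entry i c] = 0]].

Lemma solutionS n (P : {mpoly int[n]}) A B :
  A `<=` B -> solution P A `<=` solution P B.
Proof.
by move=> AB c [inj Ac Pc]; split=> // i; have [a /AB Ba <-] := Ac i; exists a.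
Qed.

(** [iota_ultrafilter P U] says that [solution P A] is nonempty for all A
    in U. *)
Lemma solution_ex n (P : {mpoly int[n]}) (A : set posnat) :
  solution P A !=set0 <-> exists a : 'I_n -> posnat,
    [/\ injective a, forall i, A (a i) & P.@[int_of_posnat \o a] = 0].
Proof.
split=> [[c [inj Ac Pc]]|[a [inj Aa Pa]]].
  have /choice[a /all_and2[Aa ac]] :
      forall i : 'I_n, exists b, A b /\ int_of_posnat b = entry i c.
    by move=> i; have [b Ab bc] := Ac i; exists b.
  exists a; split=> // [i j aij|]; first by apply: inj; rewrite -!ac aij.
  by rewrite -Pc; apply: meval_eq.
have entrya (i : 'I_n) :
    entry i (code [seq int_of_posnat (a j) | j <- enum 'I_n]) = int_of_posnat (a i).
  by rewrite /entry codeK nth_enum_ord_map.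
exists (code [seq int_of_posnat (a j) | j <- enum 'I_n]); split=> [i j|i|].
- by rewrite !entrya => -[/val_inj/inj].
- by rewrite entrya; exists (a i).
- by rewrite -Pa; apply: meval_eq => i; rewrite entrya.
Qed.

(** * The ultrafilter of the sets whose star contains a given hyperinteger *)

Section Transfer.
Variable M : nonstandard_model.
Implicit Types (S T : set int) (A : set posnat) (q x y : hyperint M).

(* [FOp] has bounded quantifiers of its own; unless it is opaque, simplifying
   the satisfaction of a formula unfolds them and hides the instances of
   [sat_op]. *)
Local Opaque FOp.

Definition intset S : std M := Defs.mkset (@std_int M @` S).

Lemma intsetP S : is_set (intset S) /\ elems (intset S) = @std_int M @` S.
Proof.
by apply: (@mksetP _ _ 0 _ _) => _ [c _ <-]; apply: rank_std_int.
Qed.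

Lemma elems_intset S c : elems (intset S) (std_int M c) <-> S c.
Proof.
by rewrite (intsetP S).2; split=> [[d Sd /std_int_inj <-]|Sc] //; exists c.
Qed.

Definition hyperset S : set (hyperint M) :=
  [set x | elems (star (intset S)) (val x)].

Lemma star_intset_sub S : elems (star (intset S)) `<=` elems (star (std_ints M)).
Proof.
have /transfer H : sat (env [:: std_ints M; intset S]) (FAll 1 (FMem 0 1)).
  rewrite /= /env /= elems_std_ints (intsetP S).2 => _ [c _ <-].
  by exists c.
exact: H.
Qed.

Lemma hypersetT q : hyperset setT q.
Proof. exact: set_mem (valP q). Qed.

Lemma hypersetI S T q : hyperset (S `&` T) q <-> hyperset S q /\ hyperset T q.
Proof.
pose phi := FAll 0 (FAnd
  (FImp (FMem 0 4) (FAnd (FMem 0 2) (FMem 0 3)))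
  (FImp (FAnd (FMem 0 2) (FMem 0 3)) (FMem 0 4))).
have /transfer H :
    sat (env [:: std_ints M; intset S; intset T; intset (S `&` T)]) phi.
  move=> x; rewrite /env /= elems_std_ints => -[c _ <-].
  by rewrite !elems_intset.
by have [] := H _ (set_mem (valP q)).
Qed.

Lemma hypersetC S q : hyperset (~` S) q <-> ~ hyperset S q.
Proof.
pose phi := FAll 0 (FAnd
  (FImp (FMem 0 3) (FNot (FMem 0 2))) (FImp (FNot (FMem 0 2)) (FMem 0 3))).
have /transfer H : sat (env [:: std_ints M; intset S; intset (~` S)]) phi.
  move=> x; rewrite /env /= elems_std_ints => -[c _ <-].
  by rewrite !elems_intset.
by have [] := H _ (set_mem (valP q)).
Qed.

Lemma hypersetS S T q : S `<=` T -> hyperset S q -> hyperset T q.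
Proof. by move=> /setIidPl <- /hypersetI[]. Qed.

(** Together with [hypersetC], which makes it an ultrafilter, this lets finite
    conjunctions over the indices of the variables be treated by filter
    arguments, instead of by formulas whose length depends on n. *)
Instance hyperset_filter q : ProperFilter [set S | hyperset S q].
Proof.
split=> [/= q0|]; first by have := hypersetT q; rewrite -setC0 => /hypersetC.
split=> /= [|S T Sq Tq|S T]; [exact: hypersetT|exact/hypersetI|].
exact: hypersetS.
Qed.

Lemma hyperset_forall (I : finType) (S : I -> set int) q :
  hyperset [set c | forall i, S i c] q <-> forall i, hyperset (S i) q.
Proof.
split=> [+ i|]; first by apply: hypersetS => c.
exact: (@filter_forall _ I S [set S | hyperset S q]).
Qed.

(** * Hyperextensions of functions *)

(** The next four facts are all the transfer that the equational theory of
    hyperextensions of functions requires: stars preserve composition,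
    projections and constants, and therefore every identity between terms. *)
Lemma hyperop_comp (op f g : int -> int -> int) x y :
  hyperop (fun a b => op (f a b) (g a b)) x y =
  hyperop op (hyperop (M := M) f x y) (hyperop g x y).
Proof.
apply/esym/hyperopP; set u := hyperop f x y; set v := hyperop g x y.
set w := hyperop _ x y.
pose phi := FAll 0 (FAll 1 (FAll 2 (FAll 3 (FAll 4
  (FImp (FOp 6 4 3 2) (FImp (FOp 7 4 3 1) (FImp (FOp 9 4 3 0) (FOp 8 2 1 0)))))))).
have /transfer H : sat (env [:: std_ints M; op_graph M f; op_graph M g;
    op_graph M op; op_graph M (fun a b => op (f a b) (g a b))]) phi.
  move=> x'; rewrite /env /= elems_std_ints.
  move=> [a _ <-] _ [b _ <-] _ [c _ <-] _ [d _ <-] _ [e _ <-].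
  by rewrite !sat_opE /= !op_graphP => -> -> ->.
rewrite /phi /= in H; have := H _ (set_mem (valP x)) _ (set_mem (valP y))
  _ (set_mem (valP u)) _ (set_mem (valP v)) _ (set_mem (valP w)).
by rewrite !sat_opE; apply; exact/hyperopP.
Qed.

Lemma hyperop_proj1 x y : hyperop (fun a _ => a) x y = x.
Proof.
apply/hyperopP; pose phi := FAll 0 (FAll 1 (FOp 3 1 0 1)).
have /transfer H : sat (env [:: std_ints M; op_graph M (fun a _ => a)]) phi.
  move=> x'; rewrite /env /= elems_std_ints => -[a _ <-] _ [b _ <-].
  exact/sat_op/op_graphP.
exact: (sat_op _ _ _ _ _).1 (H _ (set_mem (valP x)) _ (set_mem (valP y))).
Qed.

Lemma hyperop_proj2 x y : hyperop (fun _ b => b) x y = y.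
Proof.
apply/hyperopP; pose phi := FAll 0 (FAll 1 (FOp 3 1 0 0)).
have /transfer H : sat (env [:: std_ints M; op_graph M (fun _ b => b)]) phi.
  move=> x'; rewrite /env /= elems_std_ints => -[a _ <-] _ [b _ <-].
  exact/sat_op/op_graphP.
exact: (sat_op _ _ _ _ _).1 (H _ (set_mem (valP x)) _ (set_mem (valP y))).
Qed.

Lemma hyperop_const c x y : hyperop (fun _ _ => c) x y = hyper_int M c.
Proof.
apply/hyperopP; pose phi := FAll 0 (FAll 1 (FOp 3 1 0 4)).
have /transfer H :
    sat (env [:: std_ints M; op_graph M (fun _ _ => c); std_int M c]) phi.
  move=> x'; rewrite /env /= elems_std_ints => -[a _ <-] _ [b _ <-].
  exact/sat_op/op_graphP.
exact: (sat_op _ _ _ _ _).1 (H _ (set_mem (valP x)) _ (set_mem (valP y))).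
Qed.

(** The star *f of a unary function, obtained from the star of the binary
    function (a, b) |-> f(a), which does not depend on the second argument; this
    makes [hyperop_comp] available for it. *)
Definition hyperfun (f : int -> int) q : hyperint M :=
  hyperop (fun a _ => f a) q q.

Lemma hyperfun_comp op f g q :
  hyperfun (fun c => op (f c) (g c)) q = hyperop op (hyperfun f q) (hyperfun g q).
Proof. exact: hyperop_comp. Qed.

Lemma hyperfun_op f op x y :
  hyperfun f (hyperop op x y) = hyperop (fun a b => f (op a b)) x y.
Proof. by rewrite /hyperfun -(hyperop_comp (fun a _ => f a)). Qed.

(** Los's theorem for unary predicates: *f(q) is in *S if and only if f maps
    almost all integers into S, for the ultrafilter of q. *)
Lemma hyperfun_preim f S q : hyperset S (hyperfun f q) <-> hyperset (f @^-1` S) q.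
Proof.
set y := hyperfun f q.
pose phi := FAll 0 (FAll 1 (FImp (FOp 5 1 1 0)
  (FAnd (FImp (FMem 0 3) (FMem 1 4)) (FImp (FMem 1 4) (FMem 0 3))))).
have /transfer H : sat (env [:: std_ints M; intset S; intset (f @^-1` S);
    op_graph M (fun a _ => f a)]) phi.
  move=> x'; rewrite /env /= elems_std_ints => -[a _ <-] _ [b _ <-].
  by rewrite !elems_intset => /sat_op/op_graphP ->.
rewrite /phi /= in H; have := H _ (set_mem (valP q)) _ (set_mem (valP y)).
rewrite !sat_opE => -[|] //; exact/hyperopP.
Qed.

Lemma hyperfunD f g q :
  hyperfun (fun c => f c + g c) q = hyperfun f q + hyperfun g q.
Proof. exact: hyperfun_comp. Qed.

Lemma hyperfunM f g q :
  hyperfun (fun c => f c * g c) q = hyperfun f q * hyperfun g q.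
Proof. exact: hyperfun_comp. Qed.

Lemma hyperfun_cst c q : hyperfun (fun=> c) q = hyper_int M c.
Proof. exact: hyperop_const. Qed.

Lemma hyperset1 c q : hyperset [set c] q <-> q = hyper_int M c.
Proof.
pose phi := FAll 0 (FAnd (FImp (FMem 0 2) (FEq 0 3)) (FImp (FEq 0 3) (FMem 0 2))).
have /transfer H : sat (env [:: std_ints M; intset [set c]; std_int M c]) phi.
  move=> x; rewrite /env /= elems_std_ints => -[d _ <-].
  by rewrite elems_intset /=; split=> [->|/std_int_inj].
have [H1 H2] := H _ (set_mem (valP q)).
by split=> [/H1 /= qc|qc]; [exact/val_inj|apply: H2; rewrite /= qc].
Qed.

(** Los's theorem for equality; it reduces to [hyperfun_preim], as f(c) = g(c)
    means that f - g maps c into {0}. *)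
Lemma hyperfun_eq f g q :
  hyperfun f q = hyperfun g q <-> hyperset [set c | f c = g c] q.
Proof.
have -> : [set c | f c = g c] = (fun c => f c + (-1) * g c) @^-1` [set 0].
  apply/seteqP; split=> c /=; rewrite mulN1r; first by move=> ->; rewrite subrr.
  by move=> /eqP; rewrite subr_eq0 => /eqP.
rewrite -hyperfun_preim hyperset1 hyperfunD hyperfunM hyperfun_cst.
rewrite rmorphN1 rmorph0 mulN1r; split=> [->|/eqP]; first by rewrite subrr.
by rewrite subr_eq0 => /eqP.
Qed.

(** Evaluation at q is a ring morphism f |-> *f(q) from the functions on the
    integers to the hyperintegers that maps the constant c to the hyperinteger
    c, so it commutes with polynomials. *)
Lemma hyper_eval_hyperfun n (P : {mpoly int[n]}) (p : 'I_n -> int -> int) q :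
  hyper_eval P (fun i => hyperfun (p i) q) =
  hyperfun (fun c => P.@[fun i => p i c]) q.
Proof.
have eqf f g : f =1 g -> hyperfun f q = hyperfun g q by move=> /funext ->.
elim/mpolyind: P => [|a m P _ _ IH].
  rewrite /hyper_eval mmap0 (eqf _ (fun=> 0)) => [|c]; last exact: meval0.
  by rewrite hyperfun_cst rmorph0.
have hyperfunX f k : hyperfun (fun c => f c ^+ k) q = hyperfun f q ^+ k.
  elim: k => [|k IHk]; first exact: hyperfun_cst.
  by rewrite exprS -IHk -hyperfunM; apply: eqf => c; rewrite exprS.
rewrite /hyper_eval mmapD mmapZ mmapX.
rewrite (eqf _ (fun c => a * (\prod_(i < n) p i c ^+ m i) + P.@[p^~ c])) => [|c].
  rewrite hyperfunD hyperfunM hyperfun_cst [mmap _ _ P]IH; congr (_ * _ + _).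
  rewrite /mmap1; elim: (index_enum _) => [|i r IHr].
    rewrite big_nil (eqf _ (fun=> 1)) ?hyperfun_cst ?rmorph1 // => c.
    by rewrite big_nil.
  rewrite big_cons IHr -hyperfunX -hyperfunM.
  by apply: eqf => c; rewrite big_cons.
by rewrite mevalD mevalZ mevalX.
Qed.

(** * Hyperintegers as codes of tuples of hyperintegers *)

(** Every finite tuple of hyperintegers is coded by a hyperinteger: prepending
    an entry to a sequence is a binary operation on codes, and the identities
    saying how it affects the entries carry over to its star. *)
Lemma hyperentry_surj (s : seq (hyperint M)) :
  exists q, forall i, (i < size s)%N -> hyperfun (entry i) q = s`_i.
Proof.
elim: s => [|x s [q qs]]; first by exists 0.
exists (hyperop (fun a c => code (a :: decode c)) x q) => -[|i] /= si.
  rewrite hyperfun_op -[RHS](hyperop_proj1 x q); congr hyperop.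
  by do 2!apply: funext => ?; rewrite /entry codeK.
rewrite hyperfun_op -qs // -[in RHS](hyperop_proj2 x q) hyperfun_op; congr hyperop.
by do 2!apply: funext => ?; rewrite /entry codeK.
Qed.

(** Being a solution is a finite conjunction of inequations, of memberships and
    of one equation between functions of the code, to each of which Los's
    theorem applies. *)
Lemma hyperset_solution n (P : {mpoly int[n]}) A q :
  hyperset (solution P A) q <->
  [/\ injective (fun i : 'I_n => hyperfun (entry i) q),
     forall i : 'I_n, hyperset (int_of_posnat @` A) (hyperfun (entry i) q) &
     hyper_eval P (fun i => hyperfun (entry i) q) = 0].
Proof.
have -> : solution P A =
    [set c | forall i j : 'I_n, i != j -> entry i c <> entry j c] `&`
    ([set c | forall i : 'I_n, (int_of_posnat @` A) (entry i c)] `&`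
     [set c | P.@[fun i => entry i c] = 0]).
  apply/seteqP; split=> c [inj AP].
    by move=> Pc; split=> // i j /eqP ij e; exact: ij (inj i j e).
  case: AP; split=> // i j e; apply/eqP/negPn/negP => ij; exact: inj ij e.
rewrite !hypersetI; split=> [[inj [Aq Pq]]|[inj Aq Pq]]; split.
- move=> i j; apply: contra_eq => ij; apply/eqP => /hyperfun_eq.
  move/hyperset_forall/(_ i)/hyperset_forall/(_ j): inj => inj; apply/hypersetC.
  by apply: hypersetS inj => c; apply.
- by move=> i; apply/hyperfun_preim; move/hyperset_forall: Aq; apply.
- by rewrite hyper_eval_hyperfun -[RHS](hyperfun_cst 0 q); apply/hyperfun_eq.
- apply/hyperset_forall => i; apply/hyperset_forall => j.
  have [->|ij] := eqVneq i j; first by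
    apply: hypersetS (hypersetT q) => c _ /negP[].
  have : ~ hyperset [set c | entry i c = entry j c] q.
    by move/hyperfun_eq/inj/eqP; apply/negP.
  by move/hypersetC; apply: hypersetS.
- split; first by apply/hyperset_forall => i; apply/hyperfun_preim.
  by apply/hyperfun_eq; rewrite -hyper_eval_hyperfun hyperfun_cst.
Qed.

Lemma hyperset_star_std (A : set posnat) :
  hyperset (int_of_posnat @` A) = [set x | elems (star (std_set M A)) (val x)].
Proof. by rewrite /hyperset /intset image_comp. Qed.

(** The two descriptions of the set of generators agree: the sets whose star
    contains x form a proper filter, and an ultrafilter contained in it has no
    room to grow, since it contains A or its complement for each A. *)
Lemma generatorsP (U : set_system posnat) x : UltraFilter U ->
  generators U x <-> forall A, U A -> hyperset (int_of_posnat @` A) x.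
Proof.
move=> HU; split=> [[_ ->] A|H]; first by rewrite hyperset_star_std.
have UT : U setT by exact: filterT.
split; first by have := H _ UT; rewrite hyperset_star_std.
apply/seteqP; split=> A /=; first by move/H; rewrite hyperset_star_std.
have [//|/H] := in_ultra_setVsetC A HU.
rewrite hyperset_star_std /= => Ac xA; exfalso.
have : hyperset (int_of_posnat @` (~` A) `&` int_of_posnat @` A) x.
  by apply/hypersetI; rewrite !hyperset_star_std.
move/(@filter_ex _ _ (hyperset_filter x)) => [_ [[a Aa <-] [b Ab]]].
by move=> [/val_inj ba]; apply: Aa; rewrite -ba.
Qed.

End Transfer.

(** * The enlarging property *)

Lemma filter_finite_bigcap T I (F : set_system T) (D : set I) (f : I -> set T) :
  Filter F -> finite_set D -> (forall i, D i -> F (f i)) ->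
  F (\bigcap_(i in D) f i).
Proof.
move=> FF /(@finite_fsetP {classic I}) [X ->] H.
exact: (@filter_bigI T {classic I} X f F FF).
Qed.

Lemma hypersolution_ex M n (P : {mpoly int[n]}) (U : set_system posnat) :
  continuum_enlarging M -> Filter U ->
  (forall A, U A -> solution P A !=set0) ->
  exists q : hyperint M, forall A, U A -> hyperset (solution P A) q.
Proof.
move=> HM FU Pex; pose B A := intset M (solution P A).
have [||||v Bv] := HM (std_ints M) (B @` U).
- exact: (intsetP M setT).1.
- move=> _ [A _ <-]; rewrite elems_std_ints (intsetP _ _).2; split.
    exact: (intsetP _ _).1.
  by move=> _ [c _ <-]; exists c.
(* Taking the sets of positive integers from sets of natural numbers presents
   the family as an image of the power set of the natural numbers. *)
- apply: card_le_trans (card_image_le (fun N => B (sval @^-1` N)) setT).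
  apply: subset_card_le => _ [A _ <-]; exists (sval @` A) => //; congr B.
  by apply/seteqP; split=> [a [b Ab /val_inj <-]|a Aa] //; exists a.
(* The sets A whose [solution P A] are in G have their intersection in U, and a
   solution in this intersection belongs to every member of G; outside of G,
   setT is only a default. *)
- move=> G Gfin _ GU.
  have /choice[A HA] : forall g, exists A, G g -> U A /\ B A = g.
    move=> g; have [/GU[A UA <-]|nGg] := pselect (G g).
      by exists A.
    by exists setT.
  have [c Ac] := Pex _ (filter_finite_bigcap FU Gfin (fun g Gg => (HA g Gg).1)).
  exists (std_int M c) => g Gg; rewrite -(HA g Gg).2 elems_intset.
  by apply: solutionS Ac => a; apply.
have UT : U setT by exact: filterT.
(* The enlarging property gives an object of the nonstandard superstructure,
   which still has to be recognized as a hyperinteger. *)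
have vZ : elems (star (std_ints M)) v.
  by apply: (@star_intset_sub M (solution P setT)); apply: Bv; exists setT.
by exists (SigSub (mem_set vZ)) => A UA; apply: Bv; exists A.
Qed.

(** * The bridge theorem *)

Theorem theorem2p10 (M : nonstandard_model) (HM : continuum_enlarging M)
    (n : nat) (n_gt0 : (0 < n)%N) (P : {mpoly int[n]})
    (P_vars : all_variables_occur P) (P_const : P@_0%MM = 0)
    (U : set_system posnat) (HU : UltraFilter U) :
  iota_ultrafilter P U <->
  exists x : 'I_n -> hyperint M,
    [/\ injective x, forall i, generators U (x i) & hyper_eval P x = 0].
Proof.
split=> [[_ UP]|[x [inj Ux Px]]].
  have [|q Uq] := @hypersolution_ex M n P U HM _.
    by move=> A /UP /solution_ex.
  have UT : U setT by exact: filterT.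
  have /hyperset_solution[inj _ Pq] := Uq _ UT.
  exists (fun i => hyperfun (entry i) q); split=> // i.
  by apply/generatorsP => A /Uq /hyperset_solution[_ + _]; apply.
split=> // A UA; apply/solution_ex.
have [q qx] := hyperentry_surj [seq x i | i <- enum 'I_n].
have {}qx : (fun i : 'I_n => hyperfun (entry i) q) = x.
  apply: funext => i; rewrite qx; first exact: nth_enum_ord_map.
  by rewrite size_map size_enum_ord.
suff /(@filter_ex _ _ (hyperset_filter q)) : hyperset (solution P A) q by [].
apply/hyperset_solution; rewrite qx; split=> // i.
by rewrite (congr1 (@^~ i) qx); move: (Ux i) => /generatorsP; apply.
Qed.
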